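(* Let $f,g\colon\mathbb{R}\to\mathbb{R}$ be functions satisfying $$g(x+y)-g(x)-g(y)\geq xf(y)+yf(x)\qquad\text{for all } x,y\in\mathbb{R},$$ where $f$ is odd and $f(2x)=2f(x)$ for each $x\in\mathbb{R}$. Assume additionally that for each $x\in\mathbb{R}$ there exists $k_0\in\mathbb{N}$ such that for every integer $k\geq k_0$ we have $$g\left(\frac{x}{2^k}\right)+g\left(-\frac{x}{2^k}\right)\geq 0.$$ Then the map $A\colon\mathbb{R}\to\mathbb{R}$ determined by $$g(x)=xf(x)-A(x)\qquad\text{for all } x\in\mathbb{R}$$ is additive.
   Context: A function $h\colon\mathbb{R}\to\mathbb{R}$ is additive if $h(x+y)=h(x)+h(y)$ for all $x,y\in\mathbb{R}$, and odd if $h(-x)=-h(x)$ for all $x\in\mathbb{R}$. *)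

(* Defs.v *)
From HB Require Import structures.
From mathcomp Require Import all_boot all_order all_algebra.
From mathcomp Require Import reals.

Set Implicit Arguments.
Unset Strict Implicit.
Unset Printing Implicit Defensive.

Import Order.TTheory GRing.Theory Num.Theory.

Local Open Scope ring_scope.

Definition additive_fun (R : realType) (h : R -> R) : Prop :=
  forall x y : R, h (x + y) = h x + h y.

Definition odd_fun (R : realType) (h : R -> R) : Prop :=
  forall x : R, h (- x) = - h x.

(* Main.v *)
(** Put [B x y = A (x + y) - A x - A y] and [F x y = f (x + y) - f x - f y];
the hypothesis on [g] reads [B x y <= (x + y) * F x y].  The diagonal gives
[A (2x) <= 2 A x], and [y = - x] gives [A x + A (- x) >= 0].  Since [f] is
homogeneous under dyadic scaling, the sign condition at [x / 2^k] bounds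
[2^k (A x + A (- x))] by [2 x f x] for all large [k], so [A] is odd and hence
[A (2x) = 2 A x].  Now [B] scales by [2^k] while [(x + y) * F x y] scales by
[4^k]; comparing them at [(x / 2^k, y / 2^k)] gives [B <= 0], and oddness of
[B] gives equality. *)

Require Import Defs.
From mathcomp Require Import all_boot all_order all_algebra.
From mathcomp Require Import reals.
From mathcomp Require Import ring lra.

Set Implicit Arguments.
Unset Strict Implicit.
Unset Printing Implicit Defensive.

Import Order.TTheory GRing.Theory Num.Theory.

Local Open Scope ring_scope.

(** If [b > 0], then [2 ^+ k] exceeds [c / b] once [k] reaches [Num.bound (c / b)]. *)
Lemma le0_of_pow2_bounded (R : archiRealFieldType) (b c : R) (k0 : nat) :
  (forall k, (k0 <= k)%N -> 2 ^+ k * b <= c) -> b <= 0.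
Proof.
move=> h; rewrite leNgt; apply/negP => b_gt0.
pose k := maxn k0 (Num.bound (c / b)).
have := h k (leq_maxl _ _); rewrite -ler_pdivlMr// leNgt.
by rewrite upper_nthrootP// leq_maxr.
Qed.

Lemma double_iter (R : nzRingType) (h : R -> R) :
  (forall x, h (2 * x) = 2 * h x) ->
  forall k x, h (2 ^+ k * x) = 2 ^+ k * h x.
Proof.
move=> hd; elim=> [|k IH] x; first by rewrite !expr0 !mul1r.
by rewrite exprS -mulrA hd IH mulrA.
Qed.

Lemma double_iter_le (R : numDomainType) (h : R -> R) :
  (forall x, h (2 * x) <= 2 * h x) ->
  forall k x, h (2 ^+ k * x) <= 2 ^+ k * h x.
Proof.
move=> hd; elim=> [|k IH] x; first by rewrite !expr0 !mul1r.
by rewrite exprS -!mulrA (le_trans (hd _))// ler_wpM2l.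
Qed.

Theorem theorem4p2 (R : realType) (f g A : R -> R)
  (hfg : forall x y : R, g (x + y) - g x - g y >= x * f y + y * f x)
  (f_odd : odd_fun f)
  (f_double : forall x : R, f (2 * x) = 2 * f x)
  (hg : forall x : R, exists k0 : nat, forall k : nat, (k0 <= k)%N ->
    g (x / 2 ^+ k) + g (- (x / 2 ^+ k)) >= 0)
  (hA : forall x : R, g x = x * f x - A x) :
  additive_fun A.
Proof.
have pow2_neq0 k : (2 ^+ k : R) != 0 by rewrite expf_neq0// pnatr_eq0.
have pow2K k x : x = 2 ^+ k * (x / 2 ^+ k) :> R.
  by rewrite mulrC divfK.
have hB x y : A (x + y) - A x - A y <= (x + y) * (f (x + y) - f x - f y).
  have := hfg x y; rewrite !hA; lra.
have A_double_le x : A (2 * x) <= 2 * A x.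
  have := hB x x; rewrite (_ : x + x = 2 * x); last by ring.
  rewrite f_double (_ : 2 * f x - f x - f x = 0); last by ring.
  by rewrite mulr0; lra.
have A0 : A 0 = 0.
  (* At [0] the sign condition reads [- A 0 - A 0 >= 0]; the diagonal bound gives [A 0 >= 0]. *)
  have [k0 /(_ k0 (leqnn _))] := hg 0; rewrite mul0r oppr0 hA mul0r.
  by have := A_double_le 0; rewrite mulr0; lra.
have A_sym_ge0 x : 0 <= A x + A (- x).
  by have := hB x (- x); rewrite subrr mul0r A0; lra.
have A_odd x : A (- x) = - A x.
  suff : A x + A (- x) <= 0 by have := A_sym_ge0 x; lra.
  have [k0 hk0] := hg x.
  apply: (@le0_of_pow2_bounded _ _ (2 * (x * f x)) k0) => k /hk0.
  (* With [x = 2 ^+ k * t], the sign condition becomes [A t + A (- t) <= 2 * (t * f t)]. *)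
  move: (pow2K k x); move: (x / _) => t ->.
  rewrite !hA f_odd (double_iter f_double) => ht.
  have hAt := lerD (double_iter_le A_double_le k t)
                   (double_iter_le A_double_le k (- t)).
  rewrite mulrN in hAt.
  have p_ge0 : 0 <= 2 ^+ k :> R by rewrite exprn_ge0.
  apply: (le_trans (ler_wpM2l p_ge0 hAt)).
  rewrite -mulrDr [leRHS](_ : _ = 2 ^+ k * (2 ^+ k * (2 * (t * f t)))).
    by rewrite !ler_wpM2l//; lra.
  by ring.
have A_double x : A (2 * x) = 2 * A x.
  have := A_double_le x; have := A_double_le (- x).
  by rewrite mulrN !A_odd; lra.
have A_subadd x y : A (x + y) - A x - A y <= 0.
  apply: (@le0_of_pow2_bounded _ _
    ((x + y) * (f (x + y) - f x - f y)) 0%N) => k _.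
  (* With [s = x / 2 ^+ k] and [t = y / 2 ^+ k], both sides acquire the factor [2 ^+ k * 2 ^+ k],
     which leaves [hB s t]. *)
  rewrite (pow2K k x) (pow2K k y) -mulrDr.
  move: (x / _) (y / _) => s t.
  rewrite !(double_iter A_double) !(double_iter f_double) -!mulrBr.
  rewrite -[leRHS]mulrA [in leRHS](mulrCA (s + t)).
  by rewrite !ler_wpM2l ?exprn_ge0.
move=> x y; have := A_subadd x y; have := A_subadd (- x) (- y).
by rewrite -opprD !A_odd; lra.
Qed.
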